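(* Let $(\mathcal C,\mathbb E,\mathfrak s)$ be an extriangulated category satisfying Condition (WIC), and let $\xi$ be a proper class of $\mathbb E$-triangles such that $\mathcal C$ has enough $\xi$-projectives and enough $\xi$-injectives. Then the class $\mathcal{QGI}(\xi)$ of quasi-$\xi$-Gorenstein injective objects is $\xi$-injectively resolving and closed under direct summands. Here $\xi$-injectively resolving means: $\mathcal I(\xi)\subseteq\mathcal{QGI}(\xi)$, and for every $\mathbb E$-triangle $A\to B\to C\dashrightarrow$ in $\xi$ with $A\in\mathcal{QGI}(\xi)$, one has $B\in\mathcal{QGI}(\xi)$ if and only if $C\in\mathcal{QGI}(\xi)$.
   Context: Extriangulated categories (Nakaoka–Palu). $\mathcal C$ is an additive category with a biadditive functor $\mathbb E:\mathcal C^{op}\times\mathcal C\to\mathbf{Ab}$. An element $\delta\in\mathbb E(C,A)$ is an $\mathbb E$-extension; write $a_*\delta=\mathbb E(C,a)(\delta)$ and $c^*\delta=\mathbb E(c,A)(\delta)$. A morphism $(a,c):\delta\to\delta'$ from $\delta\in\mathbb E(C,A)$ to $\delta'\in\mathbb E(C',A')$ is a pair $a:A\to A'$, $c:C\to C'$ with $a_*\delta=c^*\delta'$. Sequences $A\to B\to C$ and $A\to B'\to C$ are equivalent if there is an isomorphism $B\to B'$ compatible with $1_A,1_C$. A realization $\mathfrak s$ assigns to each $\delta\in\mathbb E(C,A)$ an equivalence class $[A\xrightarrow{x}B\xrightarrow{y}C]$ such that every morphism $(a,c)$ of extensions extends to a commutative $(a,b,c)$ between the realizing sequences; it is additive if $\mathfrak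 s(0)=[A\to A\oplus C\to C]$ and $\mathfrak s(\delta\oplus\delta')=\mathfrak s(\delta)\oplus\mathfrak s(\delta')$. The triple is extriangulated if: (ET1) $\mathbb E$ is biadditive; (ET2) $\mathfrak s$ is an additive realization; (ET3) if $A\xrightarrow{x}B\xrightarrow{y}C$, $A'\xrightarrow{x'}B'\xrightarrow{y'}C'$ realize $\delta,\delta'$ and $bx=x'a$, then there is $c$ with $cy=y'b$ and $a_*\delta=c^*\delta'$; (ET3)$^{op}$ the dual; (ET4) if $A\xrightarrow{f}B\xrightarrow{f'}D$ realizes $\delta$ and $B\xrightarrow{g}C\xrightarrow{g'}F$ realizes $\delta'$, there are an object $E$, morphisms $h=gf$, $h':C\to E$, $d:D\to E$, $e:E\to F$ with $h'g=df'$, $eh'=g'$, and $\delta''\in\mathbb E(E,A)$ realized by $A\xrightarrow{h}C\xrightarrow{h'}E$, such that $D\xrightarrow{d}E\xrightarrow{e}F$ realizes $f'_*\delta'$, $d^*\delta''=\delta$, $f_*\delta''=e^*\delta'$; (ET4)$^{op}$ the dual. If $A\xrightarrow{x}B\xrightarrow{y}C$ realizes $\delta$, then $x$ is called an inflation, $y$ a deflation, and $A\xrightarrow{x}B\xrightarrow{y}C\overset{\delta}{\dashrightarrow}$ an $\mathbb E$-triangle; it is split if $\delta=0$. Condition (WIC): if $gf$ is an inflation then so is $f$; if $gf$ is a deflation then so is $g$. Proper class. A class $\xi$ of $\mathbb E$-triangles closed under isomorphisms is proper if: (1) it is closed under finite coproducts and contains all split $\mathbb E$-triangles; (2) it is closed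 under base change (triangles realizing $c^*\delta$) and cobase change (triangles realizing $a_*\delta$); (3) it is saturated: given $\mathbb E$-triangles $A_i\to B_i\xrightarrow{y_i}C\overset{\delta_i}{\dashrightarrow}$ ($i=1,2$), if the second one and the $\mathbb E$-triangle $A_1\to M\to B_2\overset{y_2^*\delta_1}{\dashrightarrow}$ are in $\xi$, then the first one is in $\xi$. $I$ is $\xi$-injective ($I\in\mathcal I(\xi)$) if for each $\mathbb E$-triangle $A\to B\to C\dashrightarrow$ in $\xi$ the sequence $0\to\mathcal C(C,I)\to\mathcal C(B,I)\to\mathcal C(A,I)\to0$ is exact; $\xi$-projective is dual. Enough $\xi$-injectives: for each $A$ there is $A\to I\to K\dashrightarrow$ in $\xi$ with $I\in\mathcal I(\xi)$; enough $\xi$-projectives is dual. $Q$ is quasi-$\xi$-injective ($Q\in\mathcal{QI}(\xi)$) if for each $\mathbb E$-triangle $A\to Q\to B\dashrightarrow$ in $\xi$ the sequence $0\to\mathcal C(B,Q)\to\mathcal C(Q,Q)\to\mathcal C(A,Q)\to0$ is exact. An $\mathbb E$-triangle $A\to B\to C\dashrightarrow$ is $\mathcal C(\mathcal{QI}(\xi),-)$-exact if $0\to\mathcal C(Q,A)\to\mathcal C(Q,B)\to\mathcal C(Q,C)\to0$ is exact for all $Q\in\mathcal{QI}(\xi)$. A complex $\cdots\to X_1\xrightarrow{d_1}X_0\xrightarrow{d_0}X_{-1}\to\cdots$ is $\xi$-exact if for each $n$ there is an $\mathbb E$-triangle $K_{n+1}\xrightarrow{g_n}X_n\xrightarrow{f_n}K_n\dashrightarrow$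 in $\xi$ with $d_n=g_{n-1}f_n$ (its $\xi$-resolution $\mathbb E$-triangles); it is $\mathcal C(\mathcal{QI}(\xi),-)$-exact if moreover these $\mathbb E$-triangles are $\mathcal C(\mathcal{QI}(\xi),-)$-exact. An object is quasi-$\xi$-Gorenstein injective (in $\mathcal{QGI}(\xi)$) if it is one of the objects $K_n$ for some $\mathcal C(\mathcal{QI}(\xi),-)$-exact complex all of whose terms are $\xi$-injective. *)

(* Defs.v *)
(* Extriangulated categories in the sense of Nakaoka and Palu.
   Library: Mathematical Components. *)
From mathcomp Require Import all_boot all_algebra.

Set Implicit Arguments.
Unset Strict Implicit.
Unset Printing Implicit Defensive.

Import GRing.Theory.
Local Open Scope ring_scope.

(** * Additive categories *)

Record preadditive := Preadditive {
  Ob :> Type;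
  Hom : Ob -> Ob -> zmodType;
  idm : forall A, Hom A A;
  cmp : forall A B C, Hom B C -> Hom A B -> Hom A C;
  cmp1m : forall A B (f : Hom A B), cmp (idm B) f = f;
  cmpm1 : forall A B (f : Hom A B), cmp f (idm A) = f;
  cmpA : forall A B C D (h : Hom C D) (g : Hom B C) (f : Hom A B),
    cmp h (cmp g f) = cmp (cmp h g) f;
  cmpDl : forall A B C (g g' : Hom B C) (f : Hom A B),
    cmp (g + g') f = cmp g f + cmp g' f;
  cmpDr : forall A B C (g : Hom B C) (f f' : Hom A B),
    cmp g (f + f') = cmp g f + cmp g f'
}.

Arguments Hom {p} A B.
Arguments idm {p} A.
Arguments cmp {p A B C} g f.

Notation "g \c f" := (cmp g f) (at level 40, left associativity).

Definition is_iso (C : preadditive) (A B : C) (f : Hom A B) : Prop :=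
  exists g : Hom B A, g \c f = idm A /\ f \c g = idm B.

Definition is_zero_object (C : preadditive) (Z : C) : Prop :=
  forall X : C, (forall f : Hom X Z, f = 0) /\ (forall f : Hom Z X, f = 0).

Record biproduct (C : preadditive) (A B : C) := Biproduct {
  bp :> C;
  inj1 : Hom A bp;
  inj2 : Hom B bp;
  prj1 : Hom bp A;
  prj2 : Hom bp B;
  prj1_inj1 : prj1 \c inj1 = idm A;
  prj2_inj2 : prj2 \c inj2 = idm B;
  prj1_inj2 : prj1 \c inj2 = 0;
  prj2_inj1 : prj2 \c inj1 = 0;
  inj_prj : inj1 \c prj1 + inj2 \c prj2 = idm bp
}.

Arguments inj1 {C A B} b.
Arguments inj2 {C A B} b.
Arguments prj1 {C A B} b.
Arguments prj2 {C A B} b.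

Record additive_category := AdditiveCategory {
  add_cat :> preadditive;
  has_zero_object : exists Z : add_cat, is_zero_object Z;
  has_biproducts : forall A B : add_cat, inhabited (biproduct A B)
}.

Definition dsum_mor (C : preadditive) (A A' B B' : C)
    (P : biproduct A A') (Q : biproduct B B')
    (f : Hom A B) (f' : Hom A' B') : Hom P Q :=
  inj1 Q \c f \c prj1 P + inj2 Q \c f' \c prj2 P.

(** * E-extensions *)

(* [Ext X A] is E(X, A), contravariant in X and covariant in A;
   [push a d] is a_* d and [pull c d] is c^* d. *)
Record biadditive_functor (C : preadditive) := BiadditiveFunctor {
  Ext :> C -> C -> zmodType;
  push : forall X A A' : C, Hom A A' -> Ext X A -> Ext X A';
  pull : forall X X' A : C, Hom X' X -> Ext X A -> Ext X' A;
  push1 : forall X A (d : Ext X A), push (idm A) d = d;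
  pull1 : forall X A (d : Ext X A), pull (idm X) d = d;
  push_cmp : forall X A A' A'' (a' : Hom A' A'') (a : Hom A A') (d : Ext X A),
    push (a' \c a) d = push a' (push a d);
  pull_cmp : forall X X' X'' A (c : Hom X' X) (c' : Hom X'' X') (d : Ext X A),
    pull (c \c c') d = pull c' (pull c d);
  push_pull : forall X X' A A' (a : Hom A A') (c : Hom X' X) (d : Ext X A),
    push a (pull c d) = pull c (push a d);
  pushDr : forall X A A' (a : Hom A A') (d d' : Ext X A),
    push a (d + d') = push a d + push a d';
  pullDr : forall X X' A (c : Hom X' X) (d d' : Ext X A),
    pull c (d + d') = pull c d + pull c d';
  pushDl : forall X A A' (a a' : Hom A A') (d : Ext X A),
    push (a + a') d = push a d + push a' d;
  pullDl : forall X X' A (c c' : Hom X' X) (d : Ext X A),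
    pull (c + c') d = pull c d + pull c' d
}.

Arguments push {C b X A A'} a d.
Arguments pull {C b X X' A} c d.

Definition ext_morphism (C : preadditive) (E : biadditive_functor C)
    (A A' X X' : C) (a : Hom A A') (c : Hom X X')
    (d : E X A) (d' : E X' A') : Prop :=
  push a d = pull c d'.

Definition dsum_ext (C : preadditive) (E : biadditive_functor C)
    (A A' X X' : C) (P : biproduct A A') (Q : biproduct X X')
    (d : E X A) (d' : E X' A') : E Q P :=
  push (inj1 P) (pull (prj1 Q) d) + push (inj2 P) (pull (prj2 Q) d').

(* A class of triples (x, y, d) with x : A -> B, y : B -> X and d in E(X, A).
   Used both for the relation "the sequence (x, y) belongs to s(d)" and for
   classes of E-triangles. *)
Definition triangle_class (C : preadditive) (E : biadditive_functor C) :=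
  forall A B X : C, Hom A B -> Hom B X -> E X A -> Prop.

(** * Realizations *)

Definition seq_equiv (C : preadditive) (A X B B' : C)
    (x : Hom A B) (y : Hom B X) (x' : Hom A B') (y' : Hom B' X) : Prop :=
  exists b : Hom B B', is_iso b /\ b \c x = x' /\ y' \c b = y.

Section Extriangulated.
Variables (C : additive_category) (E : biadditive_functor C).
Variable s : triangle_class E.

Definition is_realization : Prop :=
  (forall (A X : C) (d : E X A), exists (B : C) (x : Hom A B) (y : Hom B X),
      forall (B' : C) (x' : Hom A B') (y' : Hom B' X),
        s x' y' d <-> seq_equiv x y x' y')
  /\
  (forall (A B X A' B' X' : C)
      (x : Hom A B) (y : Hom B X) (d : E X A)
      (x' : Hom A' B') (y' : Hom B' X') (d' : E X' A')
      (a : Hom A A') (c : Hom X X'),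
      s x y d -> s x' y' d' -> ext_morphism a c d d' ->
      exists b : Hom B B', b \c x = x' \c a /\ c \c y = y' \c b).

Definition is_additive_realization : Prop :=
  [/\ is_realization,
      (forall (A X : C) (P : biproduct A X),
        s (inj1 P) (prj2 P) 0)
    & (forall (A B X A' B' X' : C)
        (x : Hom A B) (y : Hom B X) (d : E X A)
        (x' : Hom A' B') (y' : Hom B' X') (d' : E X' A')
        (PA : biproduct A A') (PB : biproduct B B') (PX : biproduct X X'),
        s x y d -> s x' y' d' ->
        s (dsum_mor PA PB x x') (dsum_mor PB PX y y') (dsum_ext PA PX d d'))].

Definition ET3 : Prop :=
  forall (A B X A' B' X' : C)
    (x : Hom A B) (y : Hom B X) (d : E X A)
    (x' : Hom A' B') (y' : Hom B' X') (d' : E X' A')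
    (a : Hom A A') (b : Hom B B'),
    s x y d -> s x' y' d' -> b \c x = x' \c a ->
    exists c : Hom X X', c \c y = y' \c b /\ ext_morphism a c d d'.

Definition ET3op : Prop :=
  forall (A B X A' B' X' : C)
    (x : Hom A B) (y : Hom B X) (d : E X A)
    (x' : Hom A' B') (y' : Hom B' X') (d' : E X' A')
    (b : Hom B B') (c : Hom X X'),
    s x y d -> s x' y' d' -> c \c y = y' \c b ->
    exists a : Hom A A', b \c x = x' \c a /\ ext_morphism a c d d'.

Definition ET4 : Prop :=
  forall (A B D X F : C)
    (f : Hom A B) (f' : Hom B D) (d1 : E D A)
    (g : Hom B X) (g' : Hom X F) (d2 : E F B),
    s f f' d1 -> s g g' d2 ->
    exists (K : C) (h' : Hom X K) (d : Hom D K) (e : Hom K F) (d3 : E K A),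
      [/\ h' \c g = d \c f' /\ e \c h' = g',
          s (g \c f) h' d3,
          s d e (push f' d2),
          pull d d3 = d1
        & push f d3 = pull e d2].

Definition ET4op : Prop :=
  forall (A B D X F : C)
    (f : Hom B A) (f' : Hom D B) (d1 : E A D)
    (g : Hom X B) (g' : Hom F X) (d2 : E B F),
    s f' f d1 -> s g' g d2 ->
    exists (K : C) (h' : Hom K X) (d : Hom K D) (e : Hom F K) (d3 : E A K),
      [/\ g \c h' = f' \c d /\ h' \c e = g',
          s h' (f \c g) d3,
          s e d (pull f' d2),
          push d d3 = d1
        & pull f d3 = push e d2].

(* (ET1) is part of [biadditive_functor]. *)
Definition extriangulated : Prop :=
  is_additive_realization /\ [/\ ET3, ET3op, ET4 & ET4op].

Definition inflation (A B : C) (x : Hom A B) : Prop :=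
  exists (X : C) (y : Hom B X) (d : E X A), s x y d.

Definition deflation (B X : C) (y : Hom B X) : Prop :=
  exists (A : C) (x : Hom A B) (d : E X A), s x y d.

Definition WIC : Prop :=
  (forall (A B X : C) (f : Hom A B) (g : Hom B X),
     inflation (g \c f) -> inflation f) /\
  (forall (A B X : C) (f : Hom A B) (g : Hom B X),
     deflation (g \c f) -> deflation g).

(** * Proper classes of E-triangles *)

Definition triangle_iso (A B X A' B' X' : C)
    (x : Hom A B) (y : Hom B X) (d : E X A)
    (x' : Hom A' B') (y' : Hom B' X') (d' : E X' A') : Prop :=
  exists (a : Hom A A') (b : Hom B B') (c : Hom X X'),
    [/\ is_iso a, is_iso b & is_iso c] /\
    [/\ b \c x = x' \c a, c \c y = y' \c b & ext_morphism a c d d'].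

Variable xi : triangle_class E.

Definition class_of_triangles : Prop :=
  forall (A B X : C) (x : Hom A B) (y : Hom B X) (d : E X A),
    xi x y d -> s x y d.

Definition closed_under_iso : Prop :=
  forall (A B X A' B' X' : C)
    (x : Hom A B) (y : Hom B X) (d : E X A)
    (x' : Hom A' B') (y' : Hom B' X') (d' : E X' A'),
    xi x y d -> s x' y' d' -> triangle_iso x y d x' y' d' -> xi x' y' d'.

(* The empty coproduct is a split E-triangle, so binary coproducts suffice. *)
Definition closed_under_coproducts : Prop :=
  forall (A B X A' B' X' : C)
    (x : Hom A B) (y : Hom B X) (d : E X A)
    (x' : Hom A' B') (y' : Hom B' X') (d' : E X' A')
    (PA : biproduct A A') (PB : biproduct B B') (PX : biproduct X X'),
    xi x y d -> xi x' y' d' ->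
    xi (dsum_mor PA PB x x') (dsum_mor PB PX y y') (dsum_ext PA PX d d').

Definition contains_split : Prop :=
  forall (A B X : C) (x : Hom A B) (y : Hom B X),
    s x y (0 : E X A) -> xi x y (0 : E X A).

Definition closed_under_base_change : Prop :=
  forall (A B X X' B' : C) (x : Hom A B) (y : Hom B X) (d : E X A)
    (c : Hom X' X) (x' : Hom A B') (y' : Hom B' X'),
    xi x y d -> s x' y' (pull c d) -> xi x' y' (pull c d).

Definition closed_under_cobase_change : Prop :=
  forall (A B X A' B' : C) (x : Hom A B) (y : Hom B X) (d : E X A)
    (a : Hom A A') (x' : Hom A' B') (y' : Hom B' X),
    xi x y d -> s x' y' (push a d) -> xi x' y' (push a d).

Definition saturated : Prop :=
  forall (A1 B1 A2 B2 X M : C)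
    (x1 : Hom A1 B1) (y1 : Hom B1 X) (d1 : E X A1)
    (x2 : Hom A2 B2) (y2 : Hom B2 X) (d2 : E X A2)
    (m : Hom A1 M) (e : Hom M B2),
    s x1 y1 d1 -> s x2 y2 d2 -> s m e (pull y2 d1) ->
    xi x2 y2 d2 -> xi m e (pull y2 d1) -> xi x1 y1 d1.

Definition proper_class : Prop :=
  (class_of_triangles /\ closed_under_iso) /\
  [/\ closed_under_coproducts, contains_split,
      closed_under_base_change, closed_under_cobase_change & saturated].

End Extriangulated.

(** * Injectives, projectives and Gorenstein objects relative to xi *)

Definition short_exact (U V W : zmodType) (f : U -> V) (g : V -> W) : Prop :=
  [/\ injective f,
      (forall v, g v = 0 <-> exists u, f u = v)
    & (forall w, exists v, g v = w)].

(* 0 -> C(X, I) -> C(B, I) -> C(A, I) -> 0 *)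
Definition hom_to_exact (C : preadditive) (A B X : C)
    (x : Hom A B) (y : Hom B X) (I : C) : Prop :=
  short_exact (fun h : Hom X I => h \c y) (fun h : Hom B I => h \c x).

(* 0 -> C(P, A) -> C(P, B) -> C(P, X) -> 0 *)
Definition hom_from_exact (C : preadditive) (A B X : C)
    (x : Hom A B) (y : Hom B X) (P : C) : Prop :=
  short_exact (fun h : Hom P A => x \c h) (fun h : Hom P B => y \c h).

Section Relative.
Variables (C : additive_category) (E : biadditive_functor C).
Variable xi : triangle_class E.

Definition xi_injective (I : C) : Prop :=
  forall (A B X : C) (x : Hom A B) (y : Hom B X) (d : E X A),
    xi x y d -> hom_to_exact x y I.

Definition xi_projective (P : C) : Prop :=
  forall (A B X : C) (x : Hom A B) (y : Hom B X) (d : E X A),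
    xi x y d -> hom_from_exact x y P.

Definition enough_xi_injectives : Prop :=
  forall A : C, exists (I K : C) (x : Hom A I) (y : Hom I K) (d : E K A),
    xi x y d /\ xi_injective I.

Definition enough_xi_projectives : Prop :=
  forall A : C, exists (K P : C) (x : Hom K P) (y : Hom P A) (d : E A K),
    xi x y d /\ xi_projective P.

Definition quasi_xi_injective (Q : C) : Prop :=
  forall (A B : C) (x : Hom A Q) (y : Hom Q B) (d : E B A),
    xi x y d -> hom_to_exact x y Q.

Definition hom_QI_exact (A B X : C) (x : Hom A B) (y : Hom B X) : Prop :=
  forall Q : C, quasi_xi_injective Q -> hom_from_exact x y Q.

(* [diff n] is the differential d_(n+1) : X_(n+1) -> X_n; this shift keeps
   the composite of consecutive differentials well typed for every n : int. *)
Record complex := Complex {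
  term :> int -> C;
  diff : forall n : int, Hom (term (n + 1)) (term n);
  diff_diff : forall n : int, diff n \c diff (n + 1) = 0
}.

(* With the same shift, the condition d_n = g_(n-1) f_n is stated at n + 1. *)
Record xi_resolution (X : complex) := XiResolution {
  syz : int -> C;
  res_g : forall n : int, Hom (syz (n + 1)) (X n);
  res_f : forall n : int, Hom (X n) (syz n);
  res_d : forall n : int, E (syz n) (syz (n + 1));
  res_in_xi : forall n : int, xi (res_g n) (res_f n) (res_d n);
  res_diff : forall n : int, diff X n = res_g n \c res_f (n + 1)
}.

Definition resolution_QI_exact (X : complex) (R : xi_resolution X) : Prop :=
  forall n : int, hom_QI_exact (res_g R n) (res_f R n).

Definition quasi_xi_Gorenstein_injective (G : C) : Prop :=
  exists (X : complex) (R : xi_resolution X),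
    [/\ (forall n : int, xi_injective (X n)),
        resolution_QI_exact R
      & exists n : int, syz R n = G].

Definition xi_injectively_resolving (T : C -> Prop) : Prop :=
  (forall I : C, xi_injective I -> T I) /\
  (forall (A B X : C) (x : Hom A B) (y : Hom B X) (d : E X A),
     xi x y d -> T A -> (T B <-> T X)).

End Relative.

Definition direct_summand (C : preadditive) (A G : C) : Prop :=
  exists (B : C) (P : biproduct A B) (f : Hom P G), is_iso f.

Definition closed_under_direct_summands (C : preadditive) (T : C -> Prop) : Prop :=
  forall A G : C, direct_summand A G -> T G -> T A.

(* Main.v *)
(* Membership of a triangle in xi depends only on its extension: by saturation and
   enough xi-projectives, d is in xi iff t^* d = 0 for every t from a xi-projective.
   Hence xi is closed under push-outs, pull-backs, saturation and cosaturation.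
   Call G acyclic if C(Q, -) keeps every triangle of xi starting at G exact, for Q
   quasi-xi-injective; acyclic objects are closed under extensions and retracts.
   Then QGI is the largest class of acyclic objects G admitting triangles
   G' -> I -> G and G -> I -> G'' in xi with I xi-injective and G', G'' in the class,
   so that membership can be proved coinductively. Extensions are treated by a
   horseshoe lemma and its dual. If G = A (+) B embeds in an injective I with cokernel
   G'', the cokernel K of A -> I is an extension of G'' by B, and K (+) A is one of G''
   by G: this gives direct summands. Finally, for A -> B -> X with A, B in QGI, pushing
   out along an embedding of A in an injective exhibits X as a summand of an
   extension of two objects of QGI. *)
From mathcomp Require Import all_boot all_algebra.
From Stdlib Require Import ClassicalEpsilon.
Require Import Defs.

Set Implicit Arguments.
Unset Strict Implicit.
Unset Printing Implicit Defensive.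

Import GRing.Theory.
Local Open Scope ring_scope.

(** * Zero morphisms and opposites *)

Section Preadditive.
Variables (C : preadditive) (E : biadditive_functor C).

Lemma addr_idem0 (V : zmodType) (v : V) : v = v + v -> v = 0.
Proof. by move/(congr1 (fun w => w - v)); rewrite subrr addrK. Qed.

Lemma cmp0m (A B X : C) (f : Hom A B) : (0 : Hom B X) \c f = 0.
Proof. by apply: addr_idem0; rewrite -cmpDl addr0. Qed.

Lemma cmpm0 (A B X : C) (g : Hom B X) : g \c (0 : Hom A B) = 0.
Proof. by apply: addr_idem0; rewrite -cmpDr addr0. Qed.

Lemma cmpNm (A B X : C) (g : Hom B X) (f : Hom A B) : (- g) \c f = - (g \c f).
Proof. by apply/eqP; rewrite -subr_eq0 opprK -cmpDl addNr cmp0m. Qed.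

Lemma cmpmN (A B X : C) (g : Hom B X) (f : Hom A B) : g \c (- f) = - (g \c f).
Proof. by apply/eqP; rewrite -subr_eq0 opprK -cmpDr addNr cmpm0. Qed.

Lemma push_0 (X A A' : C) (a : Hom A A') : push a (0 : E X A) = 0.
Proof. by apply: addr_idem0; rewrite -pushDr addr0. Qed.

Lemma pull_0 (X X' A : C) (c : Hom X' X) : pull c (0 : E X A) = 0.
Proof. by apply: addr_idem0; rewrite -pullDr addr0. Qed.

Lemma push0 (X A A' : C) (d : E X A) : push (0 : Hom A A') d = 0.
Proof. by apply: addr_idem0; rewrite -pushDl addr0. Qed.

Lemma pull0 (X X' A : C) (d : E X A) : pull (0 : Hom X' X) d = 0.
Proof. by apply: addr_idem0; rewrite -pullDl addr0. Qed.

Lemma pullN (X X' A : C) (c : Hom X' X) (d : E X A) : pull (- c) d = - pull c d.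
Proof. by apply/eqP; rewrite -subr_eq0 opprK -pullDl addNr pull0. Qed.

Lemma push_N (X A A' : C) (a : Hom A A') (d : E X A) : push a (- d) = - push a d.
Proof. by apply/eqP; rewrite -subr_eq0 opprK -pushDr addNr push_0. Qed.

Lemma zero_object_eq (Z : C) :
  is_zero_object Z ->
  (forall X (f g : Hom X Z), f = g) /\ (forall X (f g : Hom Z X), f = g).
Proof.
by move=> Z0; split=> X f g;
  [rewrite (proj1 (Z0 X) f) (proj1 (Z0 X) g)|rewrite (proj2 (Z0 X) f) (proj2 (Z0 X) g)].
Qed.

(** The underlying object is [A] itself and the definition is transparent, so the split triangles
    [A = A -> 0] and [0 -> A = A] are literally biproduct triangles. *)
Definition biproduct_zero_r (A Z : C) (Z0 : is_zero_object Z) : biproduct A Z.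
Proof.
apply: (@Biproduct _ _ _ A (idm A) 0 (idm A) 0); rewrite ?cmp1m ?cmpm0 ?cmp0m ?addr0 //.
exact: (proj1 (zero_object_eq Z0)).
Defined.

Definition biproduct_swap (A B : C) (P : biproduct A B) : biproduct B A.
Proof.
apply: (@Biproduct _ _ _ P (inj2 P) (inj1 P) (prj2 P) (prj1 P)).
- exact: prj2_inj2.
- exact: prj1_inj1.
- exact: prj2_inj1.
- exact: prj1_inj2.
- by rewrite addrC inj_prj.
Defined.

Definition biproduct_iso (A B G : C) (P : biproduct A B) (f : Hom P G) (g : Hom G P)
  (gf : g \c f = idm P) (fg : f \c g = idm G) : biproduct A B.
Proof.
apply: (@Biproduct _ _ _ G (f \c inj1 P) (f \c inj2 P) (prj1 P \c g) (prj2 P \c g));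
  rewrite ?(cmpA _ f) -?(cmpA _ g) ?gf ?cmpm1.
- exact: prj1_inj1.
- exact: prj2_inj2.
- exact: prj1_inj2.
- exact: prj2_inj1.
- by rewrite -!cmpA -cmpDr !(cmpA _ _ g) -cmpDl inj_prj cmp1m.
Defined.

End Preadditive.

Lemma seq_equiv_sym (C : preadditive) (A X B B' : C)
    (x : Hom A B) (y : Hom B X) (x' : Hom A B') (y' : Hom B' X) :
  seq_equiv x y x' y' -> seq_equiv x' y' x y.
Proof.
move=> [b [[c [cb bc]] [bx yb]]]; exists c; split; first by exists b.
by split; [rewrite -bx cmpA cb cmp1m|rewrite -yb -cmpA bc cmpm1].
Qed.

Lemma seq_equiv_trans (C : preadditive) (A X B B' B'' : C)
    (x : Hom A B) (y : Hom B X) (x' : Hom A B') (y' : Hom B' X)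
    (x'' : Hom A B'') (y'' : Hom B'' X) :
  seq_equiv x y x' y' -> seq_equiv x' y' x'' y'' -> seq_equiv x y x'' y''.
Proof.
move=> [b [[c [cb bc]] [bx yb]]] [b' [[c' [cb' bc']] [bx' yb']]].
exists (b' \c b); split; last by split; rewrite -?cmpA ?bx ?cmpA ?yb'.
exists (c \c c'); split.
- by rewrite cmpA -(cmpA c) cb' cmpm1.
- by rewrite cmpA -(cmpA b') bc cmpm1.
Qed.

(** Only the order of arguments changes, so statements about the opposite category convert to
    statements about [C]. *)
Definition opcat (C : preadditive) : preadditive :=
  @Preadditive C (fun A B => @Hom C B A) (@idm C)
    (fun A B X g f => f \c g)
    (fun A B f => cmpm1 f) (fun A B f => cmp1m f)
    (fun A B X D h g f => esym (cmpA f g h))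
    (fun A B X g g' f => cmpDr f g g') (fun A B X g f f' => cmpDl f f' g).

Definition op_biproduct (C : preadditive) (A B : C) (P : biproduct A B) :
  @biproduct (opcat C) B A :=
  @Biproduct (opcat C) B A P (prj2 P) (prj1 P) (inj2 P) (inj1 P)
    (prj2_inj2 P) (prj1_inj1 P) (prj1_inj2 P) (prj2_inj1 P)
    (etrans (addrC _ _) (inj_prj P)).

Definition biproduct_of_op (C : preadditive) (A B : C) (P : @biproduct (opcat C) A B) :
  biproduct B A :=
  @Biproduct C B A P (prj2 P) (prj1 P) (inj2 P) (inj1 P)
    (prj2_inj2 P) (prj1_inj1 P) (prj1_inj2 P) (prj2_inj1 P)
    (etrans (addrC _ _) (inj_prj P)).

Lemma op_has_zero (C : additive_category) : exists Z : opcat C, is_zero_object Z.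
Proof.
have [Z Z0] := has_zero_object C.
by exists Z => X; split; [exact: (proj2 (Z0 X))|exact: (proj1 (Z0 X))].
Qed.

Lemma op_has_biproducts (C : additive_category) (A B : opcat C) :
  inhabited (biproduct A B).
Proof. by have [P] := has_biproducts (B : C) (A : C); exact: (inhabits (op_biproduct P)). Qed.

Definition opadd (C : additive_category) : additive_category :=
  AdditiveCategory (op_has_zero C) (@op_has_biproducts C).

Definition opext (C : additive_category) (E : biadditive_functor C) :
  biadditive_functor (opadd C).
Proof.
apply: (@BiadditiveFunctor (opadd C) (fun X A => E A X)
  (fun X A A' a d => pull (a : @Hom C A' A) d)
  (fun X X' A c d => push (c : @Hom C X X') d)) => /=.
- by move=> *; exact: pull1.
- by move=> *; exact: push1.
- by move=> *; exact: pull_cmp.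
- by move=> *; exact: push_cmp.
- by move=> *; rewrite push_pull.
- by move=> *; exact: pullDr.
- by move=> *; exact: pushDr.
- by move=> *; exact: pullDl.
- by move=> *; exact: pushDl.
Defined.

Definition optri (C : additive_category) (E : biadditive_functor C)
  (s : triangle_class E) : triangle_class (opext E) :=
  fun A B X x y d => s X B A y x d.

(** * Exact sequences of an extriangulated category *)

(* [extriangulated] without the compatibility of s with sums of extensions: this
   version passes to the opposite category with no bookkeeping of biproducts. *)
Definition weakly_extriangulated (C : additive_category) (E : biadditive_functor C)
  (s : triangle_class E) : Prop :=
  [/\ is_realization s,
      (forall (A X : C) (P : biproduct A X), s _ _ _ (inj1 P) (prj2 P) 0)
    & [/\ ET3 s, ET3op s, ET4 s & ET4op s]].

Lemma op_weakly_extriangulated (C : additive_category) (E : biadditive_functor C)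
  (s : triangle_class E) :
  weakly_extriangulated s -> weakly_extriangulated (optri s).
Proof.
move=> [[real1 real2] split_s [et3 et3op et4 et4op]]; split; [split| |split].
- move=> A X d; have [B [x [y sP]]] := real1 X A d.
  exists B, y, x => B' x' y'; rewrite /optri sP; split.
  + move=> /seq_equiv_sym [b [[c [cb bc]] [bx yb]]].
    by exists b; split; [exists c; split|split].
  + move=> [b [[c [cb bc]] [bx yb]]]; apply: seq_equiv_sym.
    by exists b; split; [exists c; split|split].
- move=> A B X A' B' X' x y d x' y' d' a c s1 s2 ac.
  have [b [e1 e2]] := real2 _ _ _ _ _ _ _ _ _ _ _ _ c a s2 s1 (esym ac).
  by exists b.
- by move=> A X P; exact: (split_s _ _ (biproduct_of_op P)).
- move=> A B X A' B' X' x y d x' y' d' a b s1 s2 e.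
  have [c [e1 e2]] := et3op _ _ _ _ _ _ _ _ _ _ _ _ b a s2 s1 (esym e).
  by exists c; split; [exact: esym|exact: esym].
- move=> A B X A' B' X' x y d x' y' d' b c s1 s2 e.
  have [a [e1 e2]] := et3 _ _ _ _ _ _ _ _ _ _ _ _ c b s2 s1 (esym e).
  by exists a; split; [exact: esym|exact: esym].
- move=> A B D X F f f' d1 g g' d2 s1 s2.
  have [K [h' [d [e [d3 []]]]]] := et4op _ _ _ _ _ _ _ _ _ _ _ s1 s2.
  by exists K, h', d, e, d3.
- move=> A B D X F f f' d1 g g' d2 s1 s2.
  have [K [h' [d [e [d3 []]]]]] := et4 _ _ _ _ _ _ _ _ _ _ _ s1 s2.
  by exists K, h', d, e, d3.
Qed.

Section Triangles.
Variables (C : additive_category) (E : biadditive_functor C) (s : triangle_class E).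
Hypothesis s_ext : weakly_extriangulated s.

Lemma realize (A X : C) (d : E X A) :
  exists (B : C) (x : Hom A B) (y : Hom B X), s x y d.
Proof.
have [[real1 _] _ _] := s_ext; have [B [x [y sP]]] := real1 _ _ d.
exists B, x, y; apply/sP; exists (idm B); rewrite cmp1m cmpm1; do 2?split=> //.
by exists (idm B); rewrite cmp1m.
Qed.

Lemma realize_unique (A X B B' : C) (x : Hom A B) (y : Hom B X)
    (x' : Hom A B') (y' : Hom B' X) (d : E X A) :
  s x y d -> s x' y' d -> seq_equiv x y x' y'.
Proof.
have [[real1 _] _ _] := s_ext; have [B0 [x0 [y0 sP]]] := real1 _ _ d.
by move=> /sP /seq_equiv_sym e1 /sP; exact: seq_equiv_trans.
Qed.

Lemma triangle_biproduct (A X : C) (P : biproduct A X) : s (inj1 P) (prj2 P) 0.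
Proof. by have [] := s_ext. Qed.

(** Comparing a triangle with the split triangles [Q = Q -> 0] and [0 -> Q = Q] yields the first
    exactness properties below. *)
Lemma triangle_id0 (A Z : C) : is_zero_object Z -> s (idm A) (0 : Hom A Z) 0.
Proof. by move=> Z0; exact: (triangle_biproduct (biproduct_zero_r A Z0)). Qed.

Lemma triangle_0id (A Z : C) : is_zero_object Z -> s (0 : Hom Z A) (idm A) 0.
Proof.
by move=> Z0; exact: (triangle_biproduct (biproduct_swap (biproduct_zero_r A Z0))).
Qed.

Section OneTriangle.
Variables (A B X : C) (x : Hom A B) (y : Hom B X) (d : E X A).
Hypothesis sd : s x y d.

Lemma triangle_cmp0 : y \c x = 0.
Proof.
have [Z Z0] := has_zero_object C; have [[_ real2] _ _] := s_ext.
have [|b [bx yb]] := real2 _ _ _ _ _ _ _ _ _ _ _ _ (idm A) 0 (triangle_id0 A Z0) sd.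
  by rewrite /ext_morphism push1 pull0.
by rewrite !cmpm1 in bx; rewrite -bx -yb cmp0m.
Qed.

Lemma weak_kernel (Q : C) (h : Hom Q B) : y \c h = 0 -> exists k, h = x \c k.
Proof.
move=> yh; have [Z Z0] := has_zero_object C; have [_ _ [_ et3op _ _]] := s_ext.
have [|a [e _]] := et3op _ _ _ _ _ _ _ _ _ _ _ _ h 0 (triangle_id0 Q Z0) sd.
  by rewrite yh cmp0m.
by exists a; rewrite -e cmpm1.
Qed.

Lemma weak_cokernel (Q : C) (h : Hom B Q) : h \c x = 0 -> exists k, h = k \c y.
Proof.
move=> hx; have [Z Z0] := has_zero_object C; have [_ _ [et3 _ _ _]] := s_ext.
have [|c [e _]] := et3 _ _ _ _ _ _ _ _ _ _ _ _ 0 h sd (triangle_0id Q Z0).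
  by rewrite hx cmpm0.
by exists c; rewrite e cmp1m.
Qed.

Lemma pull_deflation : pull y d = 0.
Proof.
have [Z Z0] := has_zero_object C; have [_ _ [_ et3op _ _]] := s_ext.
have [//|a [_ e]] := et3op _ _ _ _ _ _ _ _ _ _ _ _ (idm B) y (triangle_0id B Z0) sd.
by rewrite -e push_0.
Qed.

Lemma push_inflation : push x d = 0.
Proof.
have [Z Z0] := has_zero_object C; have [_ _ [et3 _ _ _]] := s_ext.
have [//|c [_ e]] := et3 _ _ _ _ _ _ _ _ _ _ _ _ x (idm B) sd (triangle_id0 B Z0).
by rewrite [LHS]e pull_0.
Qed.

(** As [pull c d = 0], the split triangle on [A] and [Q] maps to the given one over [c]; the middle
    map restricted to [Q] is the lift. *)
Lemma lift_deflation (Q : C) (c : Hom Q X) : pull c d = 0 -> exists b, c = y \c b.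
Proof.
move=> cd; have [[_ real2] _ _] := s_ext; have [P] := has_biproducts A Q.
have [|b [_ yb]] :=
  real2 _ _ _ _ _ _ _ _ _ _ _ _ (idm A) c (triangle_biproduct P) sd.
  by rewrite /ext_morphism push1 cd.
by exists (b \c inj2 P); rewrite cmpA -yb -cmpA prj2_inj2 cmpm1.
Qed.

(** Since [push x t = 0], the map [x] extends along the inflation of [t]; ET3 turns this extension
    into [r]. *)
Lemma push_inflation_kernel (Q : C) (t : E Q A) :
  push x t = 0 -> exists r : Hom Q X, t = pull r d.
Proof.
move=> xt; have [M [m [n st]]] := realize t.
have [[_ real2] _ [et3 _ _ _]] := s_ext; have [P] := has_biproducts B Q.
have [|b0 [bm _]] :=
  real2 _ _ _ _ _ _ _ _ _ _ _ _ x (idm Q) st (triangle_biproduct P).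
  by rewrite /ext_morphism pull1 xt.
have [|c [_ e]] := et3 _ _ _ _ _ _ _ _ _ _ _ _ (idm A) (prj1 P \c b0) st sd.
  by rewrite -cmpA bm cmpA prj1_inj1 cmp1m cmpm1.
by exists c; rewrite -e push1.
Qed.

End OneTriangle.

Lemma split_triangle (A B X : C) (x : Hom A B) (y : Hom B X) :
  s x y 0 ->
  exists (q : Hom X B) (r : Hom B A),
    [/\ r \c x = idm A, y \c q = idm X, r \c q = 0 & x \c r + q \c y = idm B].
Proof.
move=> sd; have [P] := has_biproducts A X.
have [b [[c [cb bc]] [bx yb]]] := realize_unique (triangle_biproduct P) sd.
exists (b \c inj2 P), (prj1 P \c c); split.
- by rewrite -bx cmpA -(cmpA _ c) cb cmpm1 prj1_inj1.
- by rewrite cmpA yb prj2_inj2.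
- by rewrite cmpA -(cmpA _ c) cb cmpm1 prj1_inj2.
- have -> : y = prj2 P \c c by rewrite -yb -cmpA bc cmpm1.
  by rewrite -bx -!cmpA -cmpDr !(cmpA _ _ c) -cmpDl inj_prj cmp1m.
Qed.

Definition split_biproduct (A B X : C) (x : Hom A B) (y : Hom B X) (q : Hom X B)
    (r : Hom B A) (sd : s x y 0) (rx : r \c x = idm A) (yq : y \c q = idm X)
    (rq : r \c q = 0) (xq : x \c r + q \c y = idm B) : biproduct A X :=
  Biproduct rx yq rq (triangle_cmp0 sd) xq.

(** ET4 for [x] followed by the inflation of [t] gives a row realizing [push y t = 0]; pulling the
    composed extension back along a section of this row gives [t']. *)
Lemma push_deflation_kernel (A B X Q : C) (x : Hom A B) (y : Hom B X) (d : E X A)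
    (t : E Q B) :
  s x y d -> push y t = 0 -> exists t' : E Q A, t = push x t'.
Proof.
move=> sd yt; have [M [m [n st]]] := realize t; have [_ _ [_ _ et4 _]] := s_ext.
have [K [h' [u [v [d3 [_ _ suv _ e]]]]]] := et4 _ _ _ _ _ _ _ _ _ _ _ sd st.
rewrite yt in suv; have [q [r [_ vq _ _]]] := split_triangle suv.
by exists (pull q d3); rewrite push_pull e -pull_cmp vq pull1.
Qed.

(* ET4 composes [x] with the inflation of [push x a]; the resulting cone is
   [X (+) D], whose section [D -> K] can be corrected so that it pulls the
   composed extension back to [a]. ET4op along the projection to [X] then
   gives the remaining row. *)
Lemma pushout_triangles (A B X D : C) (x : Hom A B) (y : Hom B X) (d : E X A)
    (a : E D A) :
  s x y d ->
  exists (I M : C) (e : Hom A I) (p : Hom I D) (m : Hom B M) (p' : Hom M D)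
      (k : Hom I M) (r : Hom M X),
    [/\ s e p a, s m p' (push x a) & s k r (push e d)].
Proof.
move=> sd; have [M [m [p' sm]]] := realize (push x a).
have [_ _ [_ _ et4 et4op]] := s_ext.
have [K [h' [u [v [d3 [_ sK suv ud3 xd3]]]]]] := et4 _ _ _ _ _ _ _ _ _ _ _ sd sm.
rewrite -push_cmp (triangle_cmp0 sd) push0 in suv.
have [q [r [ru vq rq uq]]] := split_triangle suv.
have vu := triangle_cmp0 suv.
have [|w qd3] := push_inflation_kernel sd (t := pull q d3 - a).
  by rewrite pushDr push_N push_pull xd3 -pull_cmp vq pull1 subrr.
(* Changing the retraction along with the section keeps [K] a biproduct of [D] and [X]. *)
pose q' := q - u \c w; pose r' := r + w \c v.
have q'd3 : pull q' d3 = a.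
  by rewrite pullDl pullN pull_cmp ud3 -qd3 opprB addrC subrK.
have vq' : v \c q' = idm D by rewrite cmpDr cmpmN vq cmpA vu cmp0m subr0.
have r'u : r' \c u = idm X by rewrite cmpDl ru -cmpA vu cmpm0 addr0.
have r'q' : r' \c q' = 0.
  by rewrite cmpDr cmpmN cmpA r'u cmp1m cmpDl rq -cmpA vq cmpm1 add0r subrr.
have uq' : q' \c v + u \c r' = idm K.
  by rewrite cmpDl cmpNm cmpDr cmpA addrACA addNr addr0 addrC uq.
have sqr := triangle_biproduct (Biproduct vq' r'u vu r'q' uq').
have [I [k [p [e [g [_ sk se _ er]]]]]] := et4op _ _ _ _ _ _ _ _ _ _ _ sqr sK.
exists I, M, e, p, m, p', k, (r' \c h'); split=> //; first by rewrite -q'd3.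
suff -> : push e d = g by [].
by rewrite -ud3 push_pull -er -pull_cmp r'u pull1.
Qed.

End Triangles.

(** * Saturated ideals of extensions and horseshoe lemmas *)

Section SaturatedIdeals.
Variables (C : additive_category) (E : biadditive_functor C) (s : triangle_class E).
Variable N : forall X A : C, E X A -> Prop.

(* Stated symmetrically so that it passes to the opposite category: the last two
   closure properties are the saturation axiom and its dual. *)
Definition saturated_ideal : Prop :=
  [/\ (forall X A A' (a : Hom A A') (d : E X A), N d -> N (push a d)),
      (forall X X' A (c : Hom X' X) (d : E X A), N d -> N (pull c d)),
      (forall A B X Y (x : Hom A B) (y : Hom B X) (d : E X A) (t : E X Y),
        s x y d -> N d -> N (pull y t) -> N t)
    & (forall A B X Y (x : Hom A B) (y : Hom B X) (d : E X A) (t : E Y A),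
        s x y d -> N d -> N (push x t) -> N t)].

End SaturatedIdeals.

Lemma op_saturated_ideal (C : additive_category) (E : biadditive_functor C)
    (s : triangle_class E) (N : forall X A : C, E X A -> Prop) :
  saturated_ideal s N ->
  @saturated_ideal (opadd C) (opext E) (optri s) (fun X A => N A X).
Proof.
move=> [Npush Npull Nsat Ncosat]; split.
- by move=> X A A' a d; exact: Npull.
- by move=> X X' A c d; exact: Npush.
- by move=> A B X Y x y d t; exact: Ncosat.
- by move=> A B X Y x y d t; exact: Nsat.
Qed.

Section Horseshoe.
Variables (C : additive_category) (E : biadditive_functor C) (s : triangle_class E).
Variable N : forall X A : C, E X A -> Prop.

(** A first pushout embeds [B] in an extension [M] of [X] by [I], which splits because
    [push e d = 0]. Pushing [b] out along the section [X -> M] embeds [M] in [W], and ET4 computes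
    the cone [K] of the composite. The last hypothesis ranges over all realizations of [a] because
    [pushout_triangles] chooses its own. *)
Lemma horseshoe (A B X D F : C) (x : Hom A B) (y : Hom B X) (d : E X A)
    (a : E D A) (b : E F X) :
  weakly_extriangulated s -> saturated_ideal s N ->
  s x y d -> N a -> N b ->
  (forall (I : C) (e : Hom A I) (p : Hom I D), s e p a -> push e d = 0) ->
  exists (I J W K : C) (e : Hom A I) (p : Hom I D) (j : Hom X J) (q : Hom J F)
      (k : Hom J W) (r : Hom W I) (w : Hom B W) (w' : Hom W K) (g : E K B)
      (u : Hom D K) (v : Hom K F) (h : E F D),
    [/\ s e p a, s j q b, s k r 0, s w w' g /\ N g & s u v h /\ N h].
Proof.
move=> s_ext [Npush Npull Nsat Ncosat] sd Na Nb ad0.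
have [I [M [e [p [m [p' [k0 [r0 [se sm sk0]]]]]]]]] := pushout_triangles s_ext a sd.
rewrite (ad0 _ _ _ se) in sk0.
have [q0 [t0 [tk rq tq kq]]] := split_triangle s_ext sk0.
have sq := triangle_biproduct s_ext
  (biproduct_swap (split_biproduct s_ext sk0 tk rq tq kq)); rewrite /= in sq.
have [J [W [j [q [m2 [p2 [k [r [sj sm2 sk]]]]]]]]] := pushout_triangles s_ext b sq.
rewrite push_0 in sk; have [_ _ [_ _ et4 _]] := s_ext.
have [K [w' [u [v [g [_ sg suv _ mg]]]]]] := et4 _ _ _ _ _ _ _ _ _ _ _ sm sm2.
exists I, J, W, K, e, p, j, q, k, r, (m2 \c m), w', g, u, v.
exists (push p' (push q0 b)); split=> //; split=> //; last exact/Npush/Npush.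
(* [push m g] is a pull-back of a push-out of [b], so cosaturation along [sm] applies. *)
apply: (Ncosat _ _ _ _ _ _ _ _ sm (Npush _ _ _ _ _ Na)).
by rewrite mg; apply/Npull/Npush.
Qed.

End Horseshoe.

Section Cohorseshoe.
Variables (C : additive_category) (E : biadditive_functor C) (s : triangle_class E).
Variable N : forall X A : C, E X A -> Prop.

(** This is [horseshoe] in the opposite category, where [A] and [X], as well as [a] and [b], trade
    places. *)
Lemma cohorseshoe (A B X D F : C) (x : Hom A B) (y : Hom B X) (d : E X A)
    (a : E A D) (b : E X F) :
  weakly_extriangulated s -> saturated_ideal s N ->
  s x y d -> N a -> N b ->
  (forall (J : C) (j : Hom F J) (q : Hom J X), s j q b -> pull q d = 0) ->
  exists (I J W K : C) (e : Hom D I) (p : Hom I A) (j : Hom F J) (q : Hom J X)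
      (k : Hom J W) (r : Hom W I) (w : Hom K W) (w' : Hom W B) (g : E B K)
      (u : Hom D K) (v : Hom K F) (h : E F D),
    [/\ s e p a, s j q b, s k r 0, s w w' g /\ N g & s u v h /\ N h].
Proof.
move=> s_ext N_ideal sd Na Nb bd0.
have := @horseshoe (opadd C) (opext E) (optri s) (fun X A => @N A X) X B A F D y x d b a
  (op_weakly_extriangulated s_ext) (op_saturated_ideal N_ideal) sd Nb Na
  (fun J q j => bd0 J j q).
move=> [J [I [W [K [q [j [p [e [r [k [w' [w [g [v [u [h H]]]]]]]]]]]]]]]].
case: H => *; exists I, J, W, K, e, p, j, q, k, r, w, w', g, u, v, h.
by split.
Qed.

End Cohorseshoe.

(** * Proper classes *)

Section Proper.
Variables (C : additive_category) (E : biadditive_functor C) (s : triangle_class E).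
Hypothesis s_extri : extriangulated s.
Variable xi : triangle_class E.
Hypothesis xi_proper : proper_class s xi.
Hypothesis enough_proj : enough_xi_projectives xi.

Definition xi_ext (X A : C) (d : E X A) : Prop :=
  exists (B : C) (x : Hom A B) (y : Hom B X), xi x y d.

Lemma extriangulated_weakly : weakly_extriangulated s.
Proof. by have [[? ? _] ?] := s_extri. Qed.
Let s_ext := extriangulated_weakly.

Lemma xi_triangle (A B X : C) (x : Hom A B) (y : Hom B X) (d : E X A) :
  xi x y d -> s x y d.
Proof. by have [[H _] _] := xi_proper; exact: H. Qed.

Lemma xi_xi_ext (A B X : C) (x : Hom A B) (y : Hom B X) (d : E X A) :
  xi x y d -> xi_ext d.
Proof. by exists B, x, y. Qed.

Lemma is_iso_id (A : C) : is_iso (idm A).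
Proof. by exists (idm A); rewrite cmp1m. Qed.

Lemma xi_ext_xi (A B X : C) (x : Hom A B) (y : Hom B X) (d : E X A) :
  s x y d -> xi_ext d -> xi x y d.
Proof.
move=> sd [B' [x' [y' xd]]]; have [[_ xi_iso] _] := xi_proper.
apply: (xi_iso _ _ _ _ _ _ _ _ _ _ _ _ xd sd).
have [b [b_iso [bx yb]]] := realize_unique s_ext (xi_triangle xd) sd.
exists (idm A), b, (idm X); split; first by split=> //; exact: is_iso_id.
by rewrite cmpm1 cmp1m bx yb /ext_morphism push1 pull1.
Qed.

(** A map from a projective lifts through the deflation, which kills [d]. Conversely, pulling [d]
    back along a deflation in [xi] from a projective gives a split triangle, and saturation returns
    [d]. *)
Lemma xi_ext_projectiveP (X A : C) (d : E X A) :
  xi_ext d <-> forall (P : C) (t : Hom P X), xi_projective xi P -> pull t d = 0.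
Proof.
split=> [[B [x [y xd]]] P t Pproj|d0].
  have [_ _ sur] := Pproj _ _ _ _ _ _ xd; have [b <-] := sur t.
  by rewrite pull_cmp (pull_deflation s_ext (xi_triangle xd)) pull_0.
have [K [P [x [y [k [xk Pproj]]]]]] := enough_proj X.
have [B [x1 [y1 sd]]] := realize s_ext d.
have [M [m [n sm]]] := realize s_ext (pull y d).
have [_ [_ xi_split _ _ xi_sat]] := xi_proper.
exists B, x1, y1; apply: (xi_sat _ _ _ _ _ _ _ _ _ _ _ _ _ _ sd (xi_triangle xk) sm xk).
by rewrite (d0 _ _ Pproj) in sm *; exact: xi_split.
Qed.

Lemma xi_ext_ideal : saturated_ideal s xi_ext.
Proof.
split.
- move=> X A A' a d /xi_ext_projectiveP d0; apply/xi_ext_projectiveP => P t Pproj.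
  by rewrite -push_pull d0 ?push_0.
- move=> X X' A c d /xi_ext_projectiveP d0; apply/xi_ext_projectiveP => P t Pproj.
  by rewrite -pull_cmp d0.
- move=> A B X Y x y d t sd /xi_ext_projectiveP d0 /xi_ext_projectiveP yt0.
  apply/xi_ext_projectiveP => P c Pproj.
  have [b ->] := lift_deflation s_ext sd (d0 _ c Pproj).
  by rewrite pull_cmp yt0.
- move=> A B X Y x y d t sd /xi_ext_projectiveP d0 /xi_ext_projectiveP xt0.
  apply/xi_ext_projectiveP => P c Pproj.
  have [|r ->] := push_inflation_kernel s_ext sd (t := pull c t).
    by rewrite push_pull xt0.
  exact: d0.
Qed.

Lemma xi_ext_push (X A A' : C) (a : Hom A A') (d : E X A) : xi_ext d -> xi_ext (push a d).
Proof. by have [H _ _ _] := xi_ext_ideal; exact: H. Qed.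

Lemma xi_ext_pull (X X' A : C) (c : Hom X' X) (d : E X A) : xi_ext d -> xi_ext (pull c d).
Proof. by have [_ H _ _] := xi_ext_ideal; exact: H. Qed.

(** * Relative injectives *)

Lemma injective_extend (I A B X : C) (x : Hom A B) (y : Hom B X) (d : E X A)
    (a : Hom A I) :
  xi_injective xi I -> s x y d -> xi_ext d -> exists b : Hom B I, a = b \c x.
Proof.
move=> Iinj sd Nd; have [_ _ sur] := Iinj _ _ _ _ _ _ (xi_ext_xi sd Nd).
by have [b <-] := sur a; exists b.
Qed.

Lemma injective_ext0 (I X : C) (d : E X I) : xi_injective xi I -> xi_ext d -> d = 0.
Proof.
move=> Iinj Nd; have [B [x [y sd]]] := realize s_ext d.
have [r rx] := injective_extend (idm I) Iinj sd Nd.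
by rewrite -[d]push1 rx push_cmp (push_inflation s_ext sd) push_0.
Qed.

Lemma zero_xi_injective (Z : C) : is_zero_object Z -> xi_injective xi Z.
Proof.
move=> /zero_object_eq [Z1 Z2] A B X x y d _; split.
- by move=> f g _; exact: Z1.
- by move=> f; split=> _; [exists 0|]; exact: Z1.
- by move=> f; exists 0; exact: Z1.
Qed.

Lemma xi_injective_ext (I J W : C) (k : Hom J W) (r : Hom W I) :
  s k r 0 -> xi_injective xi I -> xi_injective xi J -> xi_injective xi W.
Proof.
move=> sk Iinj Jinj A B X x y d xd.
have [q [t [tk rq tq kq]]] := split_triangle s_ext sk.
have dec (Y : C) (h : Hom Y W) : h = k \c (t \c h) + q \c (r \c h).
  by rewrite !cmpA -cmpDl kq cmp1m.
have [injI _ surI] := Iinj _ _ _ _ _ _ xd; have [injJ _ surJ] := Jinj _ _ _ _ _ _ xd.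
split.
- move=> f g fg; have tfg : t \c f = t \c g by apply: injJ; rewrite -!cmpA fg.
  have rfg : r \c f = r \c g by apply: injI; rewrite -!cmpA fg.
  by rewrite [f]dec [g]dec tfg rfg.
- move=> f; split=> [fx|[u <-]].
  + by have [u ->] := weak_cokernel s_ext (xi_triangle xd) fx; exists u.
  + by rewrite -cmpA (triangle_cmp0 s_ext (xi_triangle xd)) cmpm0.
- move=> f; have [f1 e1] := surJ (t \c f); have [f2 e2] := surI (r \c f).
  by exists (k \c f1 + q \c f2); rewrite cmpDl -!cmpA e1 e2 -dec.
Qed.

Lemma xi_injective_retract (I J : C) (a : Hom I J) (r : Hom J I) :
  r \c a = idm I -> xi_injective xi J -> xi_injective xi I.
Proof.
move=> ra Jinj A B X x y d xd; have [injJ _ surJ] := Jinj _ _ _ _ _ _ xd; split.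
- move=> f g fg; rewrite -[f]cmp1m -[g]cmp1m -ra -!cmpA.
  by have -> : a \c f = a \c g by apply: injJ; rewrite -!cmpA fg.
- move=> f; split=> [fx|[u <-]].
  + by have [u ->] := weak_cokernel s_ext (xi_triangle xd) fx; exists u.
  + by rewrite -cmpA (triangle_cmp0 s_ext (xi_triangle xd)) cmpm0.
- move=> f; have [g e] := surJ (a \c f); exists (r \c g).
  by rewrite -cmpA e cmpA ra cmp1m.
Qed.

(** The horseshoe lemmas choose their own middle terms; this transfers injectivity to them. *)
Lemma xi_injective_realize (A X I J : C) (x : Hom A I) (y : Hom I X)
    (x' : Hom A J) (y' : Hom J X) (d : E X A) :
  s x y d -> s x' y' d -> xi_injective xi J -> xi_injective xi I.
Proof.
move=> s1 s2; have [b [[c [cb _]] _]] := realize_unique s_ext s1 s2.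
exact: xi_injective_retract cb.
Qed.

Lemma injective_quasi_injective (I : C) : xi_injective xi I -> quasi_xi_injective xi I.
Proof. by move=> Iinj A B x y d; exact: Iinj. Qed.

(** * Objects acyclic with respect to quasi-injectives *)

(* By enough xi-injectives these two conditions amount to: every triangle of xi
   starting at [G] stays short exact under C(Q, -). The second one is needed because
   inflations are not monomorphisms. *)
Definition QI_acyclic (G : C) : Prop :=
  forall Q : C, quasi_xi_injective xi Q ->
    (forall t : E Q G, xi_ext t -> t = 0) /\
    (forall f : Hom Q G,
       (forall (J : C) (j : Hom G J), xi_injective xi J -> j \c f = 0) -> f = 0).

Lemma QI_acyclic_exact (A B X : C) (x : Hom A B) (y : Hom B X) (d : E X A) :
  QI_acyclic A -> xi x y d -> hom_QI_exact xi x y.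
Proof.
move=> acA xd Q Qinj; have [ext0 mono0] := acA Q Qinj; have sd := xi_triangle xd.
split.
- move=> f g fg; apply/eqP; rewrite -subr_eq0; apply/eqP/mono0 => J j Jinj.
  have [j' ->] := injective_extend j Jinj sd (xi_xi_ext xd).
  by rewrite -cmpA cmpDr cmpmN [x \c f]fg subrr cmpm0.
- move=> f; split=> [yf|[u <-]].
  + by have [u ->] := weak_kernel s_ext sd yf; exists u.
  + by rewrite cmpA (triangle_cmp0 s_ext sd) cmp0m.
- move=> f; have [b ->] := lift_deflation s_ext sd
    (ext0 (pull f d) (xi_ext_pull f (xi_xi_ext xd))).
  by exists b.
Qed.

(** [push x t] vanishes because [I] is injective, so [t] is pulled back from [d] along some [r]; by
    exactness [r] lifts to [I], where [d] vanishes. *)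
Lemma QI_exact_acyclic (A I X : C) (x : Hom A I) (y : Hom I X) (d : E X A) :
  xi x y d -> xi_injective xi I -> hom_QI_exact xi x y -> QI_acyclic A.
Proof.
move=> xd Iinj QIx Q Qinj; have [inj_x _ sur] := QIx Q Qinj; have sd := xi_triangle xd.
split=> [t Nt|f f0].
- have xt0 : push x t = 0 by apply: injective_ext0 Iinj _; exact: xi_ext_push.
  have [r ->] := push_inflation_kernel s_ext sd xt0; have [b <-] := sur r.
  by rewrite pull_cmp (pull_deflation s_ext sd) pull_0.
- by apply: inj_x; rewrite f0 // cmpm0.
Qed.

Lemma QI_acyclic_retract (A G : C) (a : Hom A G) (r : Hom G A) :
  r \c a = idm A -> QI_acyclic G -> QI_acyclic A.
Proof.
move=> ra acG Q Qinj; have [ext0 mono0] := acG Q Qinj; split=> [t Nt|f f0].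
- by rewrite -[t]push1 -ra push_cmp (ext0 (push a t)) ?push_0 //; exact: xi_ext_push.
- rewrite -[f]cmp1m -ra -cmpA (mono0 (a \c f)) ?cmpm0 // => J j Jinj.
  by rewrite cmpA f0.
Qed.

(** Acyclicity of [X] moves both conditions from [B] down to [A]: cosaturation keeps the extension
    in [xi], and maps from [A] to injectives extend to [B]. *)
Lemma QI_acyclic_ext (A B X : C) (x : Hom A B) (y : Hom B X) (d : E X A) :
  xi x y d -> QI_acyclic A -> QI_acyclic X -> QI_acyclic B.
Proof.
move=> xd acA acX Q Qinj; have sd := xi_triangle xd.
have [extA monoA] := acA Q Qinj; have [extX monoX] := acX Q Qinj.
split=> [t Nt|f f0].
- have yt : push y t = 0 by apply/extX/xi_ext_push.
  have [t' et] := push_deflation_kernel s_ext sd yt.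
  rewrite et (extA t') ?push_0 //; rewrite et in Nt.
  by have [_ _ _ cosat] := xi_ext_ideal; apply: (cosat _ _ _ _ _ _ _ _ sd) => //;
    exact: xi_xi_ext xd.
- have yf : y \c f = 0.
    by apply: monoX => J j Jinj; rewrite cmpA f0.
  have [k ek] := weak_kernel s_ext sd yf; rewrite ek (monoA k) ?cmpm0 // => J j Jinj.
  have [j' ->] := injective_extend j Jinj sd (xi_xi_ext xd).
  by rewrite -cmpA -ek f0.
Qed.

(** * Quasi-Gorenstein injective objects *)

Let QGI := quasi_xi_Gorenstein_injective xi.

Definition injective_middle (A B : C) : Prop :=
  exists (I : C) (x : Hom A I) (y : Hom I B) (d : E B A),
    xi x y d /\ xi_injective xi I.

Lemma QGI_unfold (G : C) :
  QGI G ->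
  [/\ QI_acyclic G, exists2 G', QGI G' & injective_middle G' G
     & exists2 G', QGI G' & injective_middle G G'].
Proof.
move=> [X [R [injX QIR [n <-]]]]; have syzG m : QGI (syz R m).
  by exists X, R; split=> //; exists m.
have mid m : injective_middle (syz R (m + 1)) (syz R m).
  exists (X m), (res_g R m), (res_f R m), (res_d R m).
  by split; [exact: res_in_xi|exact: injX].
(* The triangle starting at the syzygy [n] has index [n - 1], the one ending there has index [n]. *)
have [m ->] : exists m, n = m + 1 by exists (n - 1); rewrite subrK.
split; last by exists (syz R m).
- exact: QI_exact_acyclic (res_in_xi R m) (injX m) (QIR m).
- by exists (syz R (m + 1 + 1)).
Qed.

(** Iterating chosen steps in both directions from [G] gives a chain of triangles indexed by the
    integers, which are spliced into a complex. *)
Lemma QGI_coinduction (T : C -> Prop) :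
  (forall G, T G ->
    [/\ QI_acyclic G, exists2 G', T G' & injective_middle G' G
      & exists2 G', T G' & injective_middle G G']) ->
  forall G, T G -> QGI G.
Proof.
move=> Tstep G TG.
have left_step (S : {G | T G}) : {S' : {G | T G} | injective_middle (sval S') (sval S)}.
  apply: constructive_indefinite_description.
  by have [_ [G' TG' mid] _] := Tstep _ (svalP S); exists (exist _ G' TG').
have right_step (S : {G | T G}) : {S' : {G | T G} | injective_middle (sval S) (sval S')}.
  apply: constructive_indefinite_description.
  by have [_ _ [G' TG' mid]] := Tstep _ (svalP S); exists (exist _ G' TG').
pose S0 : {G | T G} := exist _ G TG.
(* [Negz m] is [-(m + 1)], hence [m.+1] steps to the right. *)
pose S (n : int) := match n with
  | Posz m => iter m (fun S => sval (left_step S)) S0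
  | Negz m => iter m.+1 (fun S => sval (right_step S)) S0
  end.
have mid (n : int) : injective_middle (sval (S (n + 1))) (sval (S n)).
  case: n => [m|[|m]].
  - by rewrite -PoszD addn1; exact: svalP (left_step (S m)).
  - by rewrite NegzE addNr; exact: svalP (right_step S0).
  - have -> : Negz m.+1 + 1 = Negz m by rewrite !NegzE -addn1 PoszD opprD subrK.
    exact: svalP (right_step (S (Negz m))).
pose datum (n : int) := {I : C & {g : Hom (sval (S (n + 1))) I & {f : Hom I (sval (S n)) &
  {d : E (sval (S n)) (sval (S (n + 1))) | xi g f d /\ xi_injective xi I}}}}.
have data (n : int) : datum n.
  have /constructive_indefinite_description [I] := mid n.
  move=> /constructive_indefinite_description [g].
  move=> /constructive_indefinite_description [f].
  move=> /constructive_indefinite_description [d H].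
  by exists I, g, f, d.
pose term n := projT1 (data n).
pose g n : Hom _ (term n) := projT1 (projT2 (data n)).
pose f n : Hom (term n) _ := projT1 (projT2 (projT2 (data n))).
pose d n := sval (projT2 (projT2 (projT2 (data n)))).
have [xid inj] : (forall n, xi (g n) (f n) (d n)) /\ (forall n, xi_injective xi (term n)).
  by split=> n; case: (svalP (projT2 (projT2 (projT2 (data n))))).
have dd n : (g n \c f (n + 1)) \c (g (n + 1) \c f (n + 1 + 1)) = 0.
  by rewrite -cmpA (cmpA (f _)) (triangle_cmp0 s_ext (xi_triangle (xid _))) cmp0m cmpm0.
pose X := @Complex C term (fun n => g n \c f (n + 1)) dd.
pose R := @XiResolution C E xi X (fun n => sval (S n)) g f d xid (fun=> erefl).
exists X, R; split=> // [n|]; last by exists 0.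
(* Exactness at [n] comes from acyclicity of the first object, of index [n + 1]. *)
apply: QI_acyclic_exact (xid n).
by have [] := Tstep _ (svalP (S (n + 1))).
Qed.

Lemma xi_split (A B X : C) (x : Hom A B) (y : Hom B X) : s x y 0 -> xi x y 0.
Proof. by have [_ [_ H _ _ _]] := xi_proper; exact: H. Qed.

Lemma xi_biproduct (A B X A' B' X' : C) (x : Hom A B) (y : Hom B X) (d : E X A)
    (x' : Hom A' B') (y' : Hom B' X') (d' : E X' A')
    (PA : biproduct A A') (PB : biproduct B B') (PX : biproduct X X') :
  xi x y d -> xi x' y' d' ->
  xi (dsum_mor PA PB x x') (dsum_mor PB PX y y') (dsum_ext PA PX d d').
Proof. by have [_ [H _ _ _ _]] := xi_proper; exact: H. Qed.

Lemma injective_acyclic (I : C) : xi_injective xi I -> QI_acyclic I.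
Proof.
move=> Iinj Q _; split=> [t|f f0]; first exact: injective_ext0.
by rewrite -[f]cmp1m f0.
Qed.

Lemma injective_QGI (I : C) : xi_injective xi I -> QGI I.
Proof.
move: I; apply: QGI_coinduction => I Iinj.
have [Z Z0] := has_zero_object C; have Zinj := zero_xi_injective Z0.
split; first exact: injective_acyclic.
- by exists Z => //; exists I, 0, (idm I), 0; split=> //;
    exact: (xi_split (triangle_0id s_ext I Z0)).
- by exists Z => //; exists I, (idm I), 0, 0; split=> //;
    exact: (xi_split (triangle_id0 s_ext I Z0)).
Qed.

(** The coinduction runs on extensions of two objects of [QGI]: each horseshoe lemma produces [K] as
    another such extension. *)
Lemma QGI_extension (A B X : C) (x : Hom A B) (y : Hom B X) (d : E X A) :
  xi x y d -> QGI A -> QGI X -> QGI B.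
Proof.
pose T (B : C) := exists (A X : C) (x : Hom A B) (y : Hom B X) (d : E X A),
  [/\ xi x y d, QGI A & QGI X].
suff TG : forall B, T B -> QGI B by move=> *; apply: TG; exists A, X, x, y, d.
apply: QGI_coinduction => {A B X x y d} B [A [X [x [y [d [xd GA GX]]]]]].
have sd := xi_triangle xd.
have [acA [A1 GA1 [I1 [e1 [p1 [a1 [xa1 I1inj]]]]]] [A2 GA2 [I2 [e2 [p2 [a2 [xa2 I2inj]]]]]]]
  := QGI_unfold GA.
have [acX [X1 GX1 [J1 [j1 [q1 [b1 [xb1 J1inj]]]]]] [X2 GX2 [J2 [j2 [q2 [b2 [xb2 J2inj]]]]]]]
  := QGI_unfold GX.
split; first exact: QI_acyclic_ext xd _ _.
- have [|I [J [W [K [e [p [j [q [k [r [w [w' [g [u [v [h H]]]]]]]]]]]]]]]] :=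
    cohorseshoe s_ext xi_ext_ideal sd (xi_xi_ext xa1) (xi_xi_ext xb1).
    (* [J] is injective, hence quasi-injective, so acyclicity of [A] gives [pull q d = 0]. *)
    move=> J j q sj.
    have Jinj := xi_injective_realize sj (xi_triangle xb1) J1inj.
    have [ext0 _] := acA J (injective_quasi_injective Jinj).
    exact: ext0 _ (xi_ext_pull q (xi_xi_ext xd)).
  have [se sj sk [sw Ng] [su Nh]] := H.
  exists K; first by exists A1, X1, u, v, h; split=> //; exact: xi_ext_xi.
  exists W, w, w', g; split; first exact: xi_ext_xi.
  apply: xi_injective_ext sk _ _.
  + exact: xi_injective_realize se (xi_triangle xa1) I1inj.
  + exact: xi_injective_realize sj (xi_triangle xb1) J1inj.
- have [|I [J [W [K [e [p [j [q [k [r [w [w' [g [u [v [h H]]]]]]]]]]]]]]]] :=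
    horseshoe s_ext xi_ext_ideal sd (xi_xi_ext xa2) (xi_xi_ext xb2).
    (* On this side [push e d = 0] because [I] is injective. *)
    move=> I e p se; apply: injective_ext0 _ (xi_ext_push e (xi_xi_ext xd)).
    exact: xi_injective_realize se (xi_triangle xa2) I2inj.
  have [se sj sk [sw Ng] [su Nh]] := H.
  exists K; first by exists A2, X2, u, v, h; split=> //; exact: xi_ext_xi.
  exists W, w, w', g; split; first exact: xi_ext_xi.
  apply: xi_injective_ext sk _ _.
  + exact: xi_injective_realize se (xi_triangle xa2) I2inj.
  + exact: xi_injective_realize sj (xi_triangle xb2) J2inj.
Qed.

(** The coinduction runs on all biproduct factors of objects of [QGI]; the new object [K] has
    complement [A]. *)
Lemma QGI_biproduct (A B : C) (P : biproduct A B) : QGI P -> QGI A.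
Proof.
pose T (A : C) := exists (B : C) (P : biproduct A B), QGI P.
suff TG : forall A, T A -> QGI A by move=> GP; apply: TG; exists B, P.
apply: QGI_coinduction => {A B P} A [B [P GP]].
have [acP [G1 GG1 [I1 [e1 [p1 [a1 [xa1 I1inj]]]]]] [G2 GG2 [I2 [e2 [p2 [a2 [xa2 I2inj]]]]]]]
  := QGI_unfold GP.
have [Z Z0] := has_zero_object C; have [_ _ [_ _ et4 et4op]] := s_ext.
have [_ _ sat cosat] := xi_ext_ideal.
split; first exact: QI_acyclic_retract (prj1_inj1 P) acP.
- have sP := triangle_biproduct s_ext (biproduct_swap P); rewrite /= in sP.
  have [K [h' [u [v [d3 [_ sd3 svu _ ed3]]]]]] :=
    et4op _ _ _ _ _ _ _ _ _ _ _ sP (xi_triangle xa1).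
  exists K; last first.
    exists I1, h', (prj1 P \c p1), d3; split=> //; apply: xi_ext_xi sd3 _.
    apply: (sat _ _ _ _ _ _ _ _ sP (xi_xi_ext (xi_split sP))).
    by rewrite ed3; exact/xi_ext_push/xi_xi_ext/xa1.
  have [PK] := has_biproducts K A; exists A, PK.
  (* Adding [0 -> A = A] to [G1 -> K -> B] makes [PK] an extension of [P] by [G1]; the biproducts
     chosen for the ends have exactly these objects. *)
  apply: (QGI_extension (A := biproduct_zero_r G1 Z0) (X := biproduct_swap P)) => //.
  apply: xi_biproduct (xi_split (triangle_0id s_ext A Z0)).
  exact/(xi_ext_xi svu)/xi_ext_pull/xi_xi_ext/xa1.
- have sP := triangle_biproduct s_ext P.
  have [K [h' [u [v [d3 [_ sd3 suv _ ed3]]]]]] :=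
    et4 _ _ _ _ _ _ _ _ _ _ _ sP (xi_triangle xa2).
  exists K; last first.
    exists I2, (e2 \c inj1 P), h', d3; split=> //; apply: xi_ext_xi sd3 _.
    apply: (cosat _ _ _ _ _ _ _ _ sP (xi_xi_ext (xi_split sP))).
    by rewrite ed3; exact/xi_ext_pull/xi_xi_ext/xa2.
  have [PK] := has_biproducts K A; exists A, PK.
  (* Dually, adding [A = A -> 0] to [B -> K -> G2] makes [PK] an extension of [G2] by [P]. *)
  apply: (QGI_extension (A := biproduct_swap P) (X := biproduct_zero_r G2 Z0)) => //.
  apply: xi_biproduct (xi_split (triangle_id0 s_ext A Z0)).
  exact/(xi_ext_xi suv)/xi_ext_push/xi_xi_ext/xa2.
Qed.

Lemma QGI_cokernel (A B X : C) (x : Hom A B) (y : Hom B X) (d : E X A) :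
  xi x y d -> QGI A -> QGI B -> QGI X.
Proof.
move=> xd /QGI_unfold [_ _ [A' GA' [J [i [q [a [xa Jinj]]]]]]] GB.
have [I [M [e [p [m [p' [k [r [se sm sk]]]]]]]]] :=
  pushout_triangles s_ext a (xi_triangle xd).
have Iinj := xi_injective_realize se (xi_triangle xa) Jinj.
(* [M] is an extension of [A'] by [B] and of [X] by the injective [I]; the second splits, so [X] is
   a summand of [M]. *)
rewrite (injective_ext0 Iinj (xi_ext_push e (xi_xi_ext xd))) in sk.
have GM : QGI M.
  by apply: QGI_extension (xi_ext_xi sm (xi_ext_push x (xi_xi_ext xa))) _ _.
have [f [t [tk rf tf kf]]] := split_triangle s_ext sk.
exact: (QGI_biproduct (P := biproduct_swap (split_biproduct s_ext sk tk rf tf kf))).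
Qed.

End Proper.

Theorem theorem4p9 (C : additive_category) (E : biadditive_functor C)
    (s : triangle_class E) (s_extri : extriangulated s) (s_WIC : WIC s)
    (xi : triangle_class E) (xi_proper : proper_class s xi)
    (enough_proj : enough_xi_projectives xi)
    (enough_inj : enough_xi_injectives xi) :
  xi_injectively_resolving xi (quasi_xi_Gorenstein_injective xi) /\
  closed_under_direct_summands (quasi_xi_Gorenstein_injective xi).
Proof.
split; [split|].
- move=> I; exact: (injective_QGI s_extri xi_proper).
- move=> A B X x y d xd GA; split=> G.
  + exact: (QGI_cokernel s_extri xi_proper enough_proj xd).
  + exact: (QGI_extension s_extri xi_proper enough_proj xd).
- move=> A G [B [P [f [g [gf fg]]]]] GG.
  exact: (QGI_biproduct s_extri xi_proper enough_proj (P := biproduct_iso gf fg)).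
Qed.
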